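(* Let $k\ge2$, $\sigma=\sigma_0\cdots\sigma_{k-1}\in\{+,-\}^k$, and let $n\ge2$ be an integer. Then: (1) if $\sigma_0=\sigma_{k-1}=+$, then $|\mathcal A_n(\Sigma_\sigma)|\le a(n,k)+(k-2)k^{n-2}$; (2) if $\sigma_0\ne\sigma_{k-1}$, then $|\mathcal A_n(\Sigma_\sigma)|\le a(n,k)+(k-1)k^{n-2}$; (3) if $\sigma_0=\sigma_{k-1}=-$, then $|\mathcal A_n(\Sigma_\sigma)|\le a(n,k)+(k^2-2)k^{n-3}$.
   Context: $\mathcal W_k$ is the set of infinite words $s_1s_2\cdots$ over $\{0,\dots,k-1\}$; $T^-_\sigma=\{t:\sigma_t=-\}$. Order $\prec_\sigma$: for $s\ne t$, with $j$ minimal such that $s_j\ne t_j$ and $c=|\{1\le i<j:s_i\in T^-_\sigma\}|$, $s\prec_\sigma t$ iff ($c$ even and $s_j<t_j$) or ($c$ odd and $s_j>t_j$). The signed shift is $\Sigma_\sigma(s_1s_2\cdots)=s_2s_3\cdots$. For distinct elements $x_1,\dots,x_n$ of a linearly ordered set, $\rho(x_1,\dots,x_n)$ is the permutation of $[n]$ with the same relative order. $\mathrm{Pat}(s,\Sigma_\sigma,n)=\rho(s,\Sigma_\sigma(s),\dots,\Sigma_\sigma^{n-1}(s))$ (w.r.t. $\prec_\sigma$) when these words are pairwise distinct, undefined otherwise; $\mathcal A_n(\Sigma_\sigma)$ is the set of all defined such patterns. A finite word $q$ is primitive if it is not of the form $r^m$ with $m>1$ ($r^m$ = concatenation of $m$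 copies of $r$). $\psi_k(t)$ is the number of primitive words of length $t$ over a $k$-letter alphabet, and $a(n,k)=\sum_{t=1}^{n-1}\psi_k(t)\,k^{n-t-1}$. *)

(* Defs.v *)
From mathcomp Require Import all_boot all_order all_algebra all_fingroup.
From mathcomp Require Import boolp.

Set Implicit Arguments.
Unset Strict Implicit.
Unset Printing Implicit Defensive.

Variant sign := Plus | Minus.

(* Infinite words are indexed from 0: the letter s_i is [s (i - 1)]. *)
Definition word (k : nat) := nat -> 'I_k.

Definition in_Tminus (k : nat) (sigma : k.-tuple sign) (t : 'I_k) : bool :=
  if tnth sigma t is Minus then true else false.

Definition prec (k : nat) (sigma : k.-tuple sign) (s t : word k) : Prop :=
  exists j : nat,
    [/\ forall i : nat, i < j -> s i = t i,
        s j != t j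
      & if odd #|[set i : 'I_j | in_Tminus sigma (s i)]|
        then s j > t j else s j < t j].

Definition shift (k : nat) (s : word k) : word k := fun i => s i.+1.

(* [p] is the permutation rho(x_1, ..., x_n); positions and values are shifted
   from {1, ..., n} to 'I_n. *)
Definition same_relative_order (X : Type) (lt : X -> X -> Prop) (n : nat)
    (x : 'I_n -> X) (p : 'S_n) : Prop :=
  forall i j : 'I_n, p i < p j <-> lt (x i) (x j).

Definition orbit_word (k n : nat) (s : word k) (i : 'I_n) : word k :=
  iter i (@shift k) s.

(* Pat(s, Sigma_sigma, n) is defined and equal to [p]. *)
Definition is_Pat (k : nat) (sigma : k.-tuple sign) (n : nat) (s : word k)
    (p : 'S_n) : Prop :=
  injective (@orbit_word k n s) /\
  same_relative_order (prec sigma) (@orbit_word k n s) p.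

Definition allowed (k : nat) (sigma : k.-tuple sign) (n : nat) : {set 'S_n} :=
  [set p : 'S_n | `[< exists s : word k, is_Pat sigma s p >]].

Definition primitive (T : Type) (q : seq T) : Prop :=
  ~ exists (r : seq T) (m : nat), 1 < m /\ q = flatten (nseq m r).

Definition psi (k t : nat) : nat :=
  #|[set q : t.-tuple 'I_k | `[< primitive q >]]|.

Definition a (n k : nat) : nat :=
  \sum_(1 <= t < n) psi k t * k ^ (n - t - 1).

(* Main.v *)
(** Write a realizing word as [s = w y] with [w] of length [n - 1].  Comparing
    two shifts of [s] either is decided inside [w], or reduces to comparing [y]
    with [q y] for a suffix [q] of [w], and this is the same as comparing [y]
    with [q^oo], since [q y] and [q^oo] agree up to and including the first
    place where [y] and [q^oo] differ.  As [q^oo = r^oo] for a primitive suffix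
    [r] of [w], the pattern is determined by [w] and by the number of primitive
    suffixes [r] of [w] with [r^oo] below [y].  Summing over [w] the number of
    primitive suffixes plus one gives [a n k + k ^ (n - 1)].  The improvement
    comes from the [w] having a primitive suffix [r] with [r^oo] the least or
    the greatest of all words: one extreme value of the count is then
    impossible.  *)
Require Import Defs.
From mathcomp Require Import all_boot all_order all_algebra all_fingroup.
From mathcomp Require Import boolp zify lra.

Set Implicit Arguments.
Unset Strict Implicit.
Unset Printing Implicit Defensive.

Import Order.TTheory GRing.Theory Num.Theory.

(** * The signed order: linearity, deletion of the first letter, extreme words *)

Section SignedOrder.

Variables (k : nat) (sigma : k.-tuple sign).
Implicit Types (s t u : word k) (i j d : nat).

Definition parity s j := odd #|[set i : 'I_j | in_Tminus sigma (s i)]|.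

Lemma precP s t :
  prec sigma s t <-> exists d, [/\ forall i, i < d -> s i = t i, s d != t d
    & if parity s d then t d < s d else s d < t d].
Proof. by []. Qed.

Lemma parity_sum s j : parity s j = odd (\sum_(i < j) in_Tminus sigma (s i)).
Proof.
rewrite /parity -sum1_card big_mkcond /=; congr odd.
by apply: eq_bigr => i _; rewrite inE; case: in_Tminus.
Qed.

Lemma parity0 s : parity s 0 = false.
Proof. by rewrite parity_sum big_ord0. Qed.

Lemma paritySl s j :
  parity s j.+1 = in_Tminus sigma (s 0) (+) parity (shift s) j.
Proof. by rewrite !parity_sum big_ord_recl oddD; case: in_Tminus. Qed.

Lemma paritySr s j : parity s j.+1 = parity s j (+) in_Tminus sigma (s j).
Proof. by rewrite !parity_sum big_ord_recr oddD; case: in_Tminus. Qed.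

Lemma eq_parity s t j :
  (forall i, i < j -> s i = t i) -> parity s j = parity t j.
Proof.
by move=> st; rewrite !parity_sum; congr odd; apply: eq_bigr => i _; rewrite st.
Qed.

Lemma prec_trichotomy s t : s <> t -> prec sigma s t \/ prec sigma t s.
Proof.
move=> nst; have exd : exists d, s d != t d.
  apply: contrapT => h; apply: nst; apply/funext => i; apply/eqP.
  by apply: contrapT => /negP ni; apply: h; exists i.
case: (ex_minnP exd) => d nd mind.
have eqst i : i < d -> s i = t i.
  by move=> id; apply/eqP; apply: contraTT id => /mind; rewrite -leqNgt.
have := nd; rewrite -val_eqE /= neq_ltn.
have pst := eq_parity eqst.
case E : (parity s d) => /orP[] lt; [right|left|left|right]; apply/precP;
  exists d; rewrite -?pst ?E; split => //; try by move=> i /eqst.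
  by rewrite eq_sym.
by rewrite eq_sym.
Qed.

Lemma prec_irrefl s : ~ prec sigma s s.
Proof. by case/precP => d [_]; rewrite eqxx. Qed.

Lemma prec_trans s t u : prec sigma s t -> prec sigma t u -> prec sigma s u.
Proof.
move=> /precP[d [st nst lst]] /precP[e [tu ntu ltu]]; apply/precP.
have pst := eq_parity st.
case: (ltngtP d e) => [de|ed|E].
- exists d; rewrite -tu //; split=> // i id.
  by rewrite st // tu // (ltn_trans id).
- exists e; rewrite st //; split=> //.
    by move=> i ie; rewrite st ?tu // (ltn_trans ie).
  by rewrite (@eq_parity s t) // => i ie; rewrite st // (ltn_trans ie).
subst e; exists d; split; first by move=> i id; rewrite st ?tu.
  rewrite -val_eqE /=; move: lst ltu; rewrite pst.
  by case: parity => h1 h2; rewrite neq_ltn ?(ltn_trans h1 h2) // (ltn_trans h2 h1) orbT.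
move: lst ltu; rewrite pst.
by case: parity => h1 h2; [exact: ltn_trans h2 h1 | exact: ltn_trans h1 h2].
Qed.

Lemma prec_asym s t : prec sigma s t -> ~ prec sigma t s.
Proof. by move=> st ts; exact: (prec_irrefl (prec_trans st ts)). Qed.

Lemma prec_head_neq s t : s 0 != t 0 -> prec sigma s t <-> s 0 < t 0.
Proof.
move=> n0; split=> [/precP[[|d] [st _]]|l0].
- by rewrite parity0.
- by rewrite (st 0) ?eqxx // in n0.
by apply/precP; exists 0; rewrite parity0.
Qed.

(** A common first letter enters the sign count at the first difference, so deleting it reverses the
    comparison exactly when its sign is [Minus]. *)
Lemma prec_shift s t : s 0 = t 0 ->
  prec sigma s t <-> if in_Tminus sigma (s 0) then prec sigma (shift t) (shift s)
                     else prec sigma (shift s) (shift t).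
Proof.
move=> e0; split.
  case/precP=> [[|d] [st nd]]; first by rewrite e0 eqxx in nd.
  have st' i : i < d -> shift s i = shift t i by move=> id; exact: st.
  rewrite paritySl; case: in_Tminus => /= h; apply/precP; exists d.
    split=> //; first by move=> i /st'.
      by rewrite eq_sym.
    by rewrite -(eq_parity st'); move: h; case: parity.
  by split.
have ext d : (forall i, i < d -> shift s i = shift t i) ->
    forall i, i < d.+1 -> s i = t i by move=> st [|i] // /st.
case E: in_Tminus => /precP[d [st nd h]]; apply/precP; exists d.+1;
  rewrite paritySl E; split => //.
- by apply: ext => i /st.
- by rewrite eq_sym.
- rewrite (@eq_parity (shift s) (shift t)); last by move=> i /st.
  by move: h; case: parity.
- exact: ext.
Qed.

(** A greedy recursion: [parity s j] depends only on the letters before [j], and the letter at [j]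
    is the best one for that parity. *)
Definition minword s :=
  forall j, s j = (if parity s j then k.-1 else 0) :> nat.

Definition maxword s :=
  forall j, s j = (if parity s j then 0 else k.-1) :> nat.

Lemma minwordP s t : minword s -> ~ prec sigma t s.
Proof.
move=> ms /precP[d [ts _]]; rewrite (eq_parity ts) ms.
by have := ltn_ord (t d); case: parity; lia.
Qed.

Lemma maxwordP s t : maxword s -> ~ prec sigma s t.
Proof.
move=> ms /precP[d [_ _]]; rewrite ms.
by have := ltn_ord (t d); case: parity; lia.
Qed.

End SignedOrder.

(** * Periodic words and primitive roots *)

Section PeriodicWords.

Variables (k : nat) (sigma : k.-tuple sign) (x0 : 'I_k).
Implicit Types (q r : seq 'I_k) (x y : word k).

Definition periodic_word q : word k := fun j => nth x0 q (j %% size q).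

Lemma periodic_wordD q j : periodic_word q (size q + j) = periodic_word q j.
Proof. by rewrite /periodic_word modnDl. Qed.

Lemma size_flatten_nseq (T : Type) m (r : seq T) :
  size (flatten (nseq m r)) = m * size r.
Proof. by elim: m => //= m IH; rewrite size_cat IH mulSn. Qed.

Lemma nth_flatten_nseq m r j : j < m * size r ->
  nth x0 (flatten (nseq m r)) j = nth x0 r (j %% size r).
Proof.
elim: m j => [|m IH] j //=; rewrite mulSn => lj.
rewrite nth_cat; case: ltnP => [h|h]; first by rewrite modn_small.
by rewrite IH ?ltn_subLR // -[in RHS](subnK h) modnDr.
Qed.

Lemma periodic_word_flatten m r : 0 < m -> 0 < size r ->
  periodic_word (flatten (nseq m r)) = periodic_word r.
Proof.
move=> m0 r0; apply/funext => j; rewrite /periodic_word size_flatten_nseq.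
rewrite nth_flatten_nseq ?ltn_mod ?muln_gt0 ?m0 //.
by rewrite modn_dvdm // dvdn_mull.
Qed.

(** If [q] is a proper power of [r], then [r] is a shorter suffix of [q] with the same infinite
    repetition; induction on the length ends at a primitive suffix. *)
Lemma primitive_suffix q : 0 < size q ->
  exists d, [/\ d < size q, primitive (drop d q)
              & periodic_word (drop d q) = periodic_word q].
Proof.
have [n] := ubnP (size q); elim: n q => // n IH q; rewrite ltnS => qn q0.
case: (pselect (primitive q)) => [pq|/contrapT[r [[|[|m]] [// _ def_q]]]].
  by exists 0; rewrite drop0.
have sq : size q = m.+2 * size r by rewrite def_q -size_flatten_nseq.
have r0 : 0 < size r by move: q0; rewrite sq; case: size; rewrite ?muln0.
have [||d [dr pd ed]] := IH r => //; first by nia.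
(* Skip all copies of [r] but the last, then the [d] letters given by the induction hypothesis for
   [r]. *)
exists (m.+1 * size r + d).
have -> : drop (m.+1 * size r + d) q = drop d r.
  rewrite def_q -[m.+2]addn1 nseqD flatten_cat drop_cat size_flatten_nseq.
  by rewrite ltnNge leq_addr addKn /= cats0.
by split; rewrite ?ed ?def_q ?periodic_word_flatten // size_flatten_nseq; lia.
Qed.

(** * Comparing [y] with [x = q y] *)

Section Prepend.

Variables (q : seq 'I_k) (x y : word k).
Hypothesis q0 : 0 < size q.
Hypothesis xq : forall j, j < size q -> x j = nth x0 q j.
Hypothesis xy : forall j, x (size q + j) = y j.

(** Prepending the nonempty [q] pushes any disagreement of [y] with [q^oo] at least one place
    further. Hence the bound [i <= d] in place of [i < d]. *)
Lemma prepend_agree d : (forall i, i < d -> y i = periodic_word q i) ->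
  forall i, i <= d -> x i = periodic_word q i.
Proof.
move=> h i id; case: (ltnP i (size q)) => [lt|le].
  by rewrite xq // /periodic_word modn_small.
by rewrite -(subnKC le) periodic_wordD xy h //; lia.
Qed.

Lemma prepend_agreeV d : (forall i, i < d -> y i = x i) ->
  forall i, i < d -> y i = periodic_word q i.
Proof.
move=> h i; have [n] := ubnP i; elim: n i => // n IH i; rewrite ltnS => le_in id.
rewrite h // (@prepend_agree i) // => j ji; apply: IH; first exact: leq_trans ji le_in.
exact: ltn_trans ji id.
Qed.

Lemma prepend_fixed : y = periodic_word q -> x = y.
Proof.
move=> e; apply/funext => i; rewrite [in RHS]e.
by apply: (@prepend_agree i) => // j _; rewrite e.
Qed.

(** At the first place [d] where [y] departs from either word, [x] and [q^oo] still carry the same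
    letter, so both comparisons are decided there in the same way. *)
Lemma prec_prependr : prec sigma y x <-> prec sigma y (periodic_word q).
Proof.
split=> /precP[d [e nd h]]; apply/precP; exists d.
  have e' := prepend_agreeV e; have ex := prepend_agree e'.
  by rewrite -(ex d).
have ex := prepend_agree e; rewrite (ex d) //; split => // i id.
by rewrite (ex i) ?e // ltnW.
Qed.

Lemma prec_prependl : prec sigma x y <-> prec sigma (periodic_word q) y.
Proof.
split=> /precP[d [e nd h]]; apply/precP; exists d.
  have e' : forall i, i < d -> y i = periodic_word q i.
    by apply: prepend_agreeV => i /e.
  have ex := prepend_agree e'; rewrite -(ex d) //; split => //.
    by move=> i /e'.
  by rewrite (@eq_parity _ _ _ x) // => i id; rewrite ex // ltnW.
have ex : forall i, i <= d -> x i = periodic_word q i.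
  by apply: prepend_agree => i /e.
rewrite (ex d) //; split => //.
  by move=> i id; rewrite (ex i) ?e // ltnW.
by rewrite (@eq_parity _ _ _ (periodic_word q)) // => i id; rewrite ex // ltnW.
Qed.

End Prepend.

End PeriodicWords.

(** * Permutations recovered from their order, and short primitive words *)

Lemma perm_rank n (p : 'S_n) (i : 'I_n) : #|[set j | p j < p i]| = p i.
Proof.
have -> : [set j | p j < p i] = p @^-1: [set v : 'I_n | v < p i].
  by apply/setP => j; rewrite !inE.
rewrite card_preimset; last exact: perm_inj.
rewrite -sum1_card (eq_bigl (fun v : 'I_n => v < p i)); last by move=> v; rewrite inE.
by rewrite (big_ord_narrow (ltnW (ltn_ord (p i)))) sum1_card card_ord.
Qed.

Lemma perm_lt_inj n (p q : 'S_n) :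
  (forall i j, p i < p j <-> q i < q j) -> p = q.
Proof.
move=> pq; apply/permP => i; apply: val_inj => /=.
rewrite -(perm_rank p) -(perm_rank q); apply: eq_card => j; rewrite !inE.
by apply/idP/idP => /pq.
Qed.

Lemma primitive1 (T : Type) (x : T) : primitive [:: x].
Proof.
move=> [r [m [m1 /(congr1 size)]]]; rewrite size_flatten_nseq /= => /esym/eqP.
by rewrite muln_eq1 => /andP[/eqP m_1]; rewrite m_1 in m1.
Qed.

Lemma primitive2 (T : Type) (x y : T) : x <> y -> primitive [:: x; y].
Proof.
move=> nxy [r [m [m1 e]]]; have /= := congr1 size e; rewrite size_flatten_nseq.
case: r e => [|z [|t r]] e /=; [by rewrite muln0 | | by nia].
by case: m m1 e => [|[|m]] //= _ [xz yz] *; apply: nxy; rewrite xz yz.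
Qed.

Lemma iter_shiftE k m (s : word k) i : iter m (@shift k) s i = s (m + i).
Proof. by elim: m i => //= m IH i; rewrite /shift IH addnS. Qed.

(** * Coding a pattern by a prefix and a count of breakpoints *)

Section PatternCode.

Variables (k : nat) (sigma : k.-tuple sign) (x0 : 'I_k) (N : nat).
Implicit Types (s : word k) (w : N.-tuple 'I_k) (y : word k).

Definition head_word s : N.-tuple 'I_k := [tuple s i | i < N].
Definition tail_word s : word k := iter N (@shift k) s.

Definition prim_suffixes w : {set 'I_N} := [set i : 'I_N | `[< primitive (drop i w) >]].

Definition breakpoint w i : word k := periodic_word x0 (drop i w).

Definition breakpoints_below w y : {set 'I_N} :=
  [set i in prim_suffixes w | `[< prec sigma (breakpoint w i) y >]].

(** This makes every comparison of [y] with a breakpoint strict; tails of words with a defined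
    pattern satisfy it. *)
Definition fits_tail w y := forall i, i < N -> y <> breakpoint w i.

Lemma breakpoints_below_sub w y :
  breakpoints_below w y \subset prim_suffixes w.
Proof. by apply/subsetP => i; rewrite inE => /andP[]. Qed.

Lemma breakpoints_below_chain w y z i : fits_tail w y -> i < N ->
  prec sigma (breakpoint w i) z -> ~ prec sigma (breakpoint w i) y ->
  breakpoints_below w y \subset breakpoints_below w z.
Proof.
move=> fy iN iz niy; have [|//|yi] := @prec_trichotomy _ sigma (breakpoint w i) y.
  by move/esym; exact: fy.
apply/subsetP => j; rewrite !inE => /andP[-> /asboolP jy] /=; apply/asboolP.
exact: prec_trans (prec_trans jy yi) iz.
Qed.

(** Both sets are initial segments of the same linearly ordered breakpoints, hence nested, so
    cardinality determines them. *)
Lemma breakpoints_below_card w y z : fits_tail w y -> fits_tail w z ->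
  #|breakpoints_below w y| = #|breakpoints_below w z| ->
  breakpoints_below w y = breakpoints_below w z.
Proof.
move=> fy fz eqc; case: (pselect (breakpoints_below w y \subset breakpoints_below w z)).
  by move=> s; apply/eqP; rewrite eqEcard s eqc /=.
move/negP/subsetPn => [i]; rewrite !inE => /andP[pi /asboolP iy].
rewrite pi /= => /asboolP niz; apply/esym/eqP; rewrite eqEcard eqc leqnn andbT.
exact: breakpoints_below_chain iy niz.
Qed.

(** This lets the primitive suffixes alone decide the comparison with every suffix. *)
Lemma breakpoint_primitive w i : i < N ->
  exists2 j : 'I_N, j \in prim_suffixes w & breakpoint w j = breakpoint w i.
Proof.
move=> iN; have [|d [dq pd ed]] := @primitive_suffix _ x0 (drop i w).
  by rewrite size_drop size_tuple subn_gt0.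
rewrite size_drop size_tuple in dq; have jN : d + i < N by lia.
rewrite drop_drop in pd ed.
by exists (Ordinal jN); [rewrite inE; apply/asboolP | ].
Qed.

Lemma breakpoints_below_prec w y z i : i < N ->
  breakpoints_below w y = breakpoints_below w z ->
  prec sigma (breakpoint w i) y <-> prec sigma (breakpoint w i) z.
Proof.
move=> iN /setP e; have [j pj <-] := breakpoint_primitive w iN.
have := e j; rewrite !inE; move: pj; rewrite inE => -> /= h.
by split=> /asboolP; [rewrite h | rewrite -h] => /asboolP.
Qed.

Lemma head_word_suffix s i : i < N -> let q := drop i (head_word s) in
  [/\ 0 < size q,
      forall j, j < size q -> iter i (@shift k) s j = nth x0 q j
    & forall j, iter i (@shift k) s (size q + j) = tail_word s j].
Proof.
move=> iN q; rewrite /q size_drop size_tuple subn_gt0; split=> // j; last first.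
  by rewrite /tail_word !iter_shiftE addnA subnKC ?(ltnW iN).
move=> jq; rewrite nth_drop iter_shiftE; have ijN : i + j < N by lia.
by rewrite (nth_map (Ordinal ijN)) ?size_enum_ord // nth_enum_ord.
Qed.

(** If [y = q^oo] then [q y = y], so the shift starting at [q] would coincide with the last
    shift. *)
Lemma orbit_fits_tail s : injective (@orbit_word k N.+1 s) ->
  fits_tail (head_word s) (tail_word s).
Proof.
move=> inj i iN e; have [q0 xq xy] := head_word_suffix s iN.
have := prepend_fixed q0 xq xy e; have iN1 : i < N.+1 by exact: ltnW.
move/(inj (Ordinal iN1) ord_max)/(congr1 val) => /= eqi.
by rewrite eqi ltnn in iN.
Qed.

(** Induction on the distance from the later start to [N]. Two starts inside the prefix are settled
    by their first letters or both move one step right; once one start is [N], the comparison is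
    that of the tail with a breakpoint. *)
Lemma prec_orbit s t i j :
  fits_tail (head_word s) (tail_word s) -> fits_tail (head_word t) (tail_word t) ->
  head_word s = head_word t ->
  breakpoints_below (head_word s) (tail_word s) =
  breakpoints_below (head_word t) (tail_word t) ->
  i <= N -> j <= N ->
  prec sigma (iter i (@shift k) s) (iter j (@shift k) s) ->
  prec sigma (iter i (@shift k) t) (iter j (@shift k) t).
Proof.
move=> fs ft eh eb.
have eb' l : l < N -> prec sigma (breakpoint (head_word s) l) (tail_word s) <->
    prec sigma (breakpoint (head_word t) l) (tail_word t).
  by move=> lN; rewrite eh; apply: breakpoints_below_prec => //; rewrite -eb eh.
have [n] := ubnP (N - maxn i j); elim: n i j => // n IH i j.
rewrite ltnS => le_n; case: (ltngtP i N) => // [iN|->] _;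
  case: (ltngtP j N) => // [jN|->] _.
- have hd l : l < N -> iter l (@shift k) s 0 = iter l (@shift k) t 0.
    move=> lN; have [q0 sq _] := head_word_suffix s lN.
    have [q0' tq _] := head_word_suffix t lN.
    by rewrite sq // tq // eh.
  case: (eqVneq (iter i (@shift k) s 0) (iter j (@shift k) s 0)) => e0; last first.
    move/(prec_head_neq sigma e0) => lt.
    by apply/prec_head_neq; rewrite -!hd.
  move/(prec_shift sigma e0) => h; apply/prec_shift; first by rewrite -!hd.
  by rewrite -hd //; move: h; case: in_Tminus; apply: (IH _.+1 _.+1) => //; lia.
- have [q0 xq xy] := head_word_suffix s iN.
  have [q0' xq' xy'] := head_word_suffix t iN.
  move/(prec_prependl sigma q0 xq xy)/(eb' i iN) => h.
  by apply/(prec_prependl sigma q0' xq' xy').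
- have [q0 xq xy] := head_word_suffix s jN.
  have [q0' xq' xy'] := head_word_suffix t jN.
  move/(prec_prependr sigma q0 xq xy)/prec_asym => h.
  apply/(prec_prependr sigma q0' xq' xy').
  (* The shared data only records breakpoints below the tail; the reverse relation follows since the
     tail of [t] equals no breakpoint. *)
  case: (@prec_trichotomy _ sigma _ _ (ft j jN)) => // /(eb' j jN) h'.
  by case: h.
by move/prec_irrefl.
Qed.

Lemma pattern_code_inj s t (p q : 'S_N.+1) :
  is_Pat sigma s p -> is_Pat sigma t q -> head_word s = head_word t ->
  #|breakpoints_below (head_word s) (tail_word s)| =
  #|breakpoints_below (head_word t) (tail_word t)| -> p = q.
Proof.
move=> [injs sp] [injt tq] eh ec.
have fs := orbit_fits_tail injs; have ft := orbit_fits_tail injt.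
have eb : breakpoints_below (head_word s) (tail_word s) =
          breakpoints_below (head_word t) (tail_word t).
  rewrite -eh in ft ec *; exact: breakpoints_below_card.
apply: perm_lt_inj => i j; split.
  by move/sp/(prec_orbit fs ft eh eb) => h; apply/tq; apply: h; rewrite -ltnS.
by move/tq/(prec_orbit ft fs (esym eh) (esym eb)) => h; apply/sp; apply: h; rewrite -ltnS.
Qed.

(** A least breakpoint differs from [y], hence lies below it and is counted. *)
Lemma minword_code w y i : fits_tail w y -> i \in prim_suffixes w ->
  minword sigma (breakpoint w i) -> 0 < #|breakpoints_below w y|.
Proof.
move=> fy pi mi; apply/card_gt0P; exists i; rewrite inE pi; apply/asboolP.
by case: (@prec_trichotomy _ sigma _ _ (fy i (ltn_ord i))) => // /(minwordP mi).
Qed.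

Lemma maxword_code w y i : i \in prim_suffixes w ->
  maxword sigma (breakpoint w i) -> #|breakpoints_below w y| < #|prim_suffixes w|.
Proof.
move=> pi mi; apply: proper_card; apply/properP.
split; first exact: breakpoints_below_sub.
by exists i; rewrite // inE pi /=; apply/asboolP; exact: maxwordP.
Qed.

Lemma card_interval_ord n lo up :
  #|[set c : 'I_n | lo <= c < up]| <= up - lo.
Proof.
rewrite cardE -(size_map val) -(size_iota lo (up - lo)); apply: uniq_leq_size.
  by rewrite map_inj_uniq ?enum_uniq //; exact: val_inj.
move=> _ /mapP[c cA ->]; move: cA; rewrite mem_enum inE mem_iota.
by move=> /andP[? ?]; apply/andP; split => //=; lia.
Qed.

(** A prefix [w] admits the counts from 0 to its number of primitive suffixes, less the value 0 if
    [w] is in [L] and less the top value if [w] is in [U]. *)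
Lemma card_allowed_le (L U : {set N.-tuple 'I_k}) :
  (forall w, w \in L ->
     exists2 i, i \in prim_suffixes w & minword sigma (breakpoint w i)) ->
  (forall w, w \in U ->
     exists2 i, i \in prim_suffixes w & maxword sigma (breakpoint w i)) ->
  #|allowed sigma N.+1| + (#|L| + #|U|) <=
    \sum_(w : N.-tuple 'I_k) #|prim_suffixes w| + k ^ N.
Proof.
move=> hL hU.
pose T := [set c : N.-tuple 'I_k * 'I_N.+1 |
  (c.1 \in L) <= c.2 < #|prim_suffixes c.1|.+1 - (c.1 \in U)].
have /choice[f fP] (p : 'S_N.+1) : exists s,
    p \in allowed sigma N.+1 -> is_Pat sigma s p.
  (* The constant word is a dummy value for permutations that are not allowed. *)
  case: (boolP (p \in _)) => [|_]; last by exists (fun=> x0).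
  by rewrite inE => /asboolP[s sp]; exists s.
pose nb p := breakpoints_below (head_word (f p)) (tail_word (f p)).
have nbN p : #|nb p| < N.+1 by rewrite ltnS -[N in _ <= N]card_ord max_card.
pose code p := (head_word (f p), Ordinal (nbN p)).
have leT : #|allowed sigma N.+1| <= #|T|.
  rewrite -(card_in_imset (f := code)); last first.
    move=> p q /fP sp /fP sq /eqP.
    rewrite xpair_eqE => /andP[/eqP eh /eqP/(congr1 val) ec].
    exact: pattern_code_inj sp sq eh ec.
  apply/subset_leq_card/subsetP => _ /imsetP[p /fP[inj _] ->]; rewrite inE /=.
  have fits := orbit_fits_tail inj; apply/andP; split.
    case: (boolP (_ \in L)) => // /hL[i pi mi]; exact: minword_code fits pi mi.
  case: (boolP (_ \in U)) => [/hU[i pi mi]|_].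
    by rewrite subn1 /=; exact: maxword_code pi mi.
  by rewrite subn0 ltnS; apply/subset_leq_card/breakpoints_below_sub.
apply: leq_trans (leq_add leT (leqnn _)) _.
have -> : k ^ N = \sum_(w : N.-tuple 'I_k) 1 by rewrite sum1_card card_tuple card_ord.
have cardE1 (A : {set N.-tuple 'I_k}) : #|A| = \sum_w (w \in A).
  by rewrite -sum1_card big_mkcond.
have -> : #|T| = \sum_(w : N.-tuple 'I_k)
    #|[set c : 'I_N.+1 | (w \in L) <= c < #|prim_suffixes w|.+1 - (w \in U)]|.
  rewrite -sum1_card (eq_bigl (fun c : N.-tuple 'I_k * 'I_N.+1 => true &&
    ((c.1 \in L) <= c.2 < #|prim_suffixes c.1|.+1 - (c.1 \in U)))); last first.
    by move=> c; rewrite inE.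
  rewrite -(pair_big_dep xpredT (fun w (c : 'I_N.+1) =>
    (w \in L) <= c < #|prim_suffixes w|.+1 - (w \in U)) (fun _ _ => 1)) /=.
  by apply: eq_bigr => w _; rewrite -[RHS]sum1_card; apply: eq_bigl => c; rewrite inE.
rewrite !cardE1 -!big_split /=; apply: leq_sum => w _.
have := card_interval_ord N.+1 (w \in L) (#|prim_suffixes w|.+1 - (w \in U)).
(* Subtraction is truncated: a word in both sets must have a primitive suffix for both savings to be
   real. *)
have : (w \in L) <= #|prim_suffixes w|.
  by case: (boolP (w \in L)) => // /hL[i pi _]; apply/card_gt0P; exists i.
by case: (w \in L); case: (w \in U) => /=; lia.
Qed.

End PatternCode.

(** * Counting primitive suffixes over all prefixes *)

Lemma card_primitive_drop k i j :
  #|[set w : (i + j).-tuple 'I_k | `[< primitive (drop i w) >]]| = psi k j * k ^ i.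
Proof.
pose A := setX [set: i.-tuple 'I_k] [set q : j.-tuple 'I_k | `[< primitive q >]].
pose glue (c : i.-tuple 'I_k * j.-tuple 'I_k) := [tuple of c.1 ++ c.2].
have glue_inj : injective glue.
  move=> [u v] [u' v'] /(congr1 val)/eqP /=; rewrite eqseq_cat ?size_tuple //.
  by case/andP => /eqP/val_inj -> /eqP/val_inj ->.
have -> : psi k j * k ^ i = #|A|.
  by rewrite cardsX cardsT card_tuple card_ord mulnC.
rewrite -(card_imset _ glue_inj); apply: eq_card => w; rewrite inE.
apply/asboolP/imsetP => [pw|[[u v] /setXP[_]]]; last first.
  by rewrite inE => /asboolP pv -> /=; rewrite drop_size_cat ?size_tuple.
have sz1 : size (take i w) == i by rewrite size_takel // size_tuple leq_addr.
have sz2 : size (drop i w) == j by rewrite size_drop size_tuple addKn.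
exists (Tuple sz1, Tuple sz2); first by rewrite !inE; apply/asboolP.
by apply: val_inj; rewrite /= cat_take_drop.
Qed.

Lemma sum_prim_suffixes k N :
  \sum_(w : N.-tuple 'I_k) #|prim_suffixes w| = a N.+1 k.
Proof.
have drop_sum i j M : M = i + j ->
    \sum_(w : M.-tuple 'I_k) `[< primitive (drop i w) >] = psi k j * k ^ i.
  move->; rewrite -card_primitive_drop -sum1_card [in RHS]big_mkcond /=.
  by apply: eq_bigr => w _; rewrite inE; case: asbool.
rewrite (eq_bigr (fun w : N.-tuple 'I_k =>
  \sum_(i < N) `[< primitive (drop i w) >])); last first.
  move=> w _; rewrite -sum1_card big_mkcond; apply: eq_bigr => i _.
  by rewrite inE; case: asbool.
(* Sum over start positions first; reversing them makes the index [i] stand for a suffix of length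
   [i.+1]. *)
rewrite exchange_big /a big_add1 /= big_mkord (reindex_inj rev_ord_inj) /=.
apply: eq_bigr => i _; have iN := ltn_ord i.
by rewrite (drop_sum _ i.+1) ?subnK // -subnDA addn1 subSS.
Qed.

Lemma card_suffix_tuples k m l (v : l.-tuple 'I_k) :
  #|[set [tuple of u ++ v] | u : m.-tuple 'I_k]| = k ^ m.
Proof.
rewrite card_imset ?card_tuple ?card_ord // => u u' /(congr1 val)/eqP /=.
by rewrite eqseq_cat ?size_tuple // => /andP[/eqP/val_inj].
Qed.

Lemma suffix_breakpoint k (x0 : 'I_k) m l (v : l.+1.-tuple 'I_k)
    (w : (m + l.+1).-tuple 'I_k) : primitive v ->
  w \in [set [tuple of u ++ v] | u : m.-tuple 'I_k] ->
  exists2 i, i \in prim_suffixes w & breakpoint x0 w i = periodic_word x0 v.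
Proof.
move=> pv /imsetP[u _ ->]; have mN : m < m + l.+1 by lia.
have dv : drop m (u ++ v) = v by rewrite drop_size_cat ?size_tuple.
by exists (Ordinal mN); rewrite ?inE /breakpoint /= dv //; apply/asboolP.
Qed.

(** * Extreme words of period one and two *)

Section ExtremeWords.

Variables (k : nat) (sigma : k.-tuple sign) (x0 : 'I_k).
Implicit Types (s : word k) (z o : 'I_k).

Lemma parity_plus s j : (forall i, in_Tminus sigma (s i) = false) ->
  parity sigma s j = false.
Proof. by move=> h; elim: j => [|j IH]; rewrite ?parity0 // paritySr h IH. Qed.

Lemma parity_minus s j : (forall i, in_Tminus sigma (s i)) ->
  parity sigma s j = odd j.
Proof. by move=> h; elim: j => [|j IH]; rewrite ?parity0 // paritySr h IH addbT. Qed.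

Lemma periodic_word1 z j : periodic_word x0 [:: z] j = z.
Proof. by rewrite /periodic_word modn1. Qed.

Lemma periodic_word2 z o j :
  periodic_word x0 [:: z; o] j = if odd j then o else z.
Proof. by rewrite /periodic_word /= modn2; case: odd. Qed.

(** Repeating a letter of sign [Plus] keeps the parity even, so the greedy choice never changes. *)
Lemma minword1 z : z = 0 :> nat -> in_Tminus sigma z = false ->
  minword sigma (periodic_word x0 [:: z]).
Proof.
by move=> z0 pz j; rewrite parity_plus => [|i]; rewrite periodic_word1.
Qed.

Lemma maxword1 o : o = k.-1 :> nat -> in_Tminus sigma o = false ->
  maxword sigma (periodic_word x0 [:: o]).
Proof.
by move=> ok po j; rewrite parity_plus => [|i]; rewrite periodic_word1.
Qed.

(** Each letter flips the parity, so the greedy choice alternates between the two end letters. *)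
Lemma minword2 z o : z = 0 :> nat -> o = k.-1 :> nat ->
  in_Tminus sigma z -> in_Tminus sigma o ->
  minword sigma (periodic_word x0 [:: z; o]).
Proof.
move=> z0 ok mz mo j; rewrite parity_minus => [|i]; rewrite periodic_word2.
  by case: odd.
by case: odd.
Qed.

Lemma maxword2 z o : z = 0 :> nat -> o = k.-1 :> nat ->
  in_Tminus sigma z -> in_Tminus sigma o ->
  maxword sigma (periodic_word x0 [:: o; z]).
Proof.
move=> z0 ok mz mo j; rewrite parity_minus => [|i]; rewrite periodic_word2.
  by case: odd.
by case: odd.
Qed.

End ExtremeWords.

(** * The three bounds *)

Lemma psi1 k : psi k 1 = k.
Proof.
rewrite /psi -[RHS]expn1 -[in RHS](card_ord k) -card_tuple -cardsT.
apply: eq_card => q; rewrite !inE; apply/asboolP.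
by case: q => [[|x [|]]] //= _; exact: primitive1.
Qed.

Theorem theorem3p1 (k : nat) (hk : (2 <= k)%N) (sigma : k.-tuple sign)
    (n : nat) (hn : (2 <= n)%N) :
  [/\ (nth Plus sigma 0 = Plus -> nth Plus sigma (k - 1) = Plus ->
        (#|allowed sigma n| <= a n k + (k - 2) * k ^ (n - 2))%N),
      (nth Plus sigma 0 <> nth Plus sigma (k - 1) ->
        (#|allowed sigma n| <= a n k + (k - 1) * k ^ (n - 2))%N)
    & (nth Plus sigma 0 = Minus -> nth Plus sigma (k - 1) = Minus ->
        ((#|allowed sigma n|)%:R <=
          (a n k)%:R + (k%:R ^+ 2 - 2) * k%:R ^ (n%:Z - 3) :> rat)%R)].
Proof.
have k0 : 0 < k by exact: ltnW.
have k1 : k - 1 < k by lia.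
pose z : 'I_k := Ordinal k0; pose o : 'I_k := Ordinal k1.
have oE : o = k.-1 :> nat by rewrite /= subn1.
have zo : z <> o by move=> /(congr1 val) /=; lia.
have Tz : in_Tminus sigma z = if nth Plus sigma 0 is Minus then true else false.
  by rewrite /in_Tminus (tnth_nth Plus).
have To : in_Tminus sigma o =
    if nth Plus sigma (k - 1) is Minus then true else false.
  by rewrite /in_Tminus (tnth_nth Plus).
have none (P : (n - 2 + 1).-tuple 'I_k -> Prop) w : w \in set0 -> P w.
  by rewrite inE.
have nE : n = (n - 2 + 1).+1 by lia.
(* Prefixes have length [n - 1]. Those ending in 0, or in [k - 1], have a one-letter suffix whose
   repetition is extreme when its sign is [Plus]; each family saves [k ^ (n - 2)]. *)
pose L := [set [tuple of u ++ [tuple z]] | u : (n - 2).-tuple 'I_k].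
pose U := [set [tuple of u ++ [tuple o]] | u : (n - 2).-tuple 'I_k].
have hL : in_Tminus sigma z = false -> forall w, w \in L ->
    exists2 i, i \in prim_suffixes w & minword sigma (breakpoint z w i).
  move=> pz w /(suffix_breakpoint z (@primitive1 _ z))[i pi ei].
  by exists i => //; rewrite ei; exact: minword1.
have hU : in_Tminus sigma o = false -> forall w, w \in U ->
    exists2 i, i \in prim_suffixes w & maxword sigma (breakpoint z w i).
  move=> pz w /(suffix_breakpoint z (@primitive1 _ o))[i pi ei].
  by exists i => //; rewrite ei; exact: maxword1.
have kE : k ^ (n - 2 + 1) = k * k ^ (n - 2) by rewrite addn1 expnS.
split.
- rewrite {}Tz {}To in hL hU => s0 s1; rewrite s0 s1 in hL hU.
  have := card_allowed_le (hL erefl) (hU erefl).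
  by rewrite sum_prim_suffixes !card_suffix_tuples -nE kE; nia.
- rewrite {}Tz {}To in hL hU => s01.
  (* Only one end letter has sign [Plus], so one family is used and the other is taken empty. *)
  have [s0|s1] : nth Plus sigma 0 = Plus \/ nth Plus sigma (k - 1) = Plus.
    by move: s01; do 2!case: nth; auto.
  + rewrite s0 in hL; have := card_allowed_le (hL erefl) (@none _).
    by rewrite sum_prim_suffixes !card_suffix_tuples cards0 -nE kE; nia.
  rewrite s1 in hU; have := card_allowed_le (@none _) (hU erefl).
  by rewrite sum_prim_suffixes !card_suffix_tuples cards0 -nE kE; nia.
move=> s0 s1; rewrite s0 in Tz; rewrite s1 in To.
(* For [n = 2] the prefix is too short for a two-letter suffix. There are only two permutations,
   [a 2 k = k] is at least 2, and the rational extra term is nonnegative. *)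
have [n2|n3] := leqP n 2.
  have {hn n2 nE} -> : n = 2 by lia.
  have le2 : #|allowed sigma 2| <= a 2 k.
    rewrite /a big_nat1 psi1 muln1; apply: leq_trans (max_card _) _.
    by rewrite card_Sn.
  apply: le_trans (_ : (a 2 k)%:R <= _)%R; first by rewrite ler_nat.
  rewrite lerDl mulr_ge0 ?exprz_ge0 ?ler0n // subr_ge0 -natrX ler_nat.
  by nia.
have {nE} nE : n = (n - 3 + 2).+1 by lia.
(* With both end signs [Minus], the extreme words alternate the end letters. Fixing the last two
   letters leaves [n - 3] free, so the two families save [2 * k ^ (n - 3)] out of [k ^ (n - 1)]. *)
pose L' := [set [tuple of u ++ [tuple z; o]] | u : (n - 3).-tuple 'I_k].
pose U' := [set [tuple of u ++ [tuple o; z]] | u : (n - 3).-tuple 'I_k].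
have hL' w : w \in L' ->
    exists2 i, i \in prim_suffixes w & minword sigma (breakpoint z w i).
  move=> /(suffix_breakpoint z (primitive2 zo))[i pi ei].
  by exists i => //; rewrite ei; exact: minword2.
have hU' w : w \in U' ->
    exists2 i, i \in prim_suffixes w & maxword sigma (breakpoint z w i).
  move=> /(suffix_breakpoint z (primitive2 (nesym zo)))[i pi ei].
  by exists i => //; rewrite ei; exact: maxword2.
have := card_allowed_le hL' hU'.
rewrite sum_prim_suffixes !card_suffix_tuples -nE -(ler_nat rat).
have -> : (n%:Z - 3 = (n - 3)%:Z)%R by lia.
by rewrite -exprnP !natrD !natrX exprD; lra.
Qed.
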